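(* Let $q$ be any prime power, $t\geq 2$ any integer, and $w\in\mathbb{F}_{q^{2t}}\setminus\mathbb{F}_{q^t}$. Then there exist $a,b\in\mathbb{F}_{q^{3t}}^*$ and an integer $1\leq i\leq 3t-1$ such that the $\mathbb{F}_q$-linear set $L_U$ of rank $3t$ of the projective plane $\mathrm{PG}(\mathbb{F}_{q^{6t}},\mathbb{F}_{q^{2t}})=\mathrm{PG}(2,q^{2t})$, where $$U=\{a x^{q^i}+b x^{q^{2t+i}}+w x : x\in\mathbb{F}_{q^{3t}}\}\subseteq\mathbb{F}_{q^{6t}},$$ is scattered.
   Context: $\mathbb{F}_{q^{6t}}$ is regarded as a 3-dimensional vector space over its subfield $\mathbb{F}_{q^{2t}}$. For an $\mathbb{F}_q$-subspace $U$ of an $\mathbb{F}_{q^n}$-vector space $V$ with $\dim_{\mathbb{F}_q}U=k$, the $\mathbb{F}_q$-linear set of rank $k$ is $L_U=\{\langle u\rangle_{\mathbb{F}_{q^n}}:u\in U\setminus\{0\}\}\subseteq\mathrm{PG}(V,\mathbb{F}_{q^n})$; it is scattered if $\dim_{\mathbb{F}_q}(U\cap\langle v\rangle_{\mathbb{F}_{q^n}})\leq 1$ for every nonzero $v\in V$. *)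

(* Defs.v *)
From HB Require Import structures.
From mathcomp Require Import all_boot all_order all_algebra all_field.

Set Implicit Arguments.
Unset Strict Implicit.
Unset Printing Implicit Defensive.

Import GRing.Theory.
Local Open Scope ring_scope.

(* An extension L of F is viewed as a vector space over an intermediate       *)
(* field K; all dimensions and subspaces are over F.                          *)

(* <v>_K = {v * k : k in K}, as an F-subspace of L. *)
Definition span_over (F : fieldType) (L : fieldExtType F) (K : {subfield L})
  (v : L) : {vspace L} := (<[v]> * K)%VS.

(* The F-linear set L_U of rank k of PG(L, K). As usual, rank and             *)
(* scatteredness belong to the defining subspace U, which the point set alone *)
(* need not determine, so U is kept as part of the data.                      *)
Record linear_set (F : fieldType) (L : fieldExtType F) (K : {subfield L})
  (k : nat) := LinearSet {
  ls_space : {vspace L};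
  ls_rank : \dim ls_space = k
}.

Definition ls_points (F : fieldType) (L : fieldExtType F) (K : {subfield L})
  (k : nat) (S : linear_set K k) (P : {vspace L}) : Prop :=
  exists u : L, [/\ u \in ls_space S, u != 0 & P = span_over K u].

Definition scattered (F : fieldType) (L : fieldExtType F) (K : {subfield L})
  (k : nat) (S : linear_set K k) : Prop :=
  forall v : L, v != 0 -> (\dim (ls_space S :&: span_over K v) <= 1)%N.

(* Main.v *)
(** Write [Q = q^t], [k = F_Q], [E = F_{Q^3}] and take [i = 1], so that
    [f x = a x^q + b x^(q Q^2)] is a semilinear map of the 3-dimensional [k]-space [E].

    Writing the dilation factor as [u + v w] with [u], [v] in [k], a failure of scatteredness
    yields either [f y = 0] or a vector [y] with [f (f y)] in [<y, f y>_k], that is, an invariant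
    point or line of [PG(E, k)]; an invariant line forces an invariant point. So it suffices
    that [f] has no eigenvector.

    Such [a], [b] exist by a second moment argument. The number [X] of eigenpoints of [f] has
    mean about [1 + 1/Q] over all pairs [(a, b)], and distinct points are independent since
    [(a, b) |-> (f y, f y')] is bijective as soon as [y'] is not in [k y]; so
    [X (X - 1)] also has mean about [1]. On the other hand the eigenpoints of a nonzero [f] lie in
    a subgeometry of order [q] (or a degenerate piece of one), whence [X <= q^2 + q + 1 <= Q] when
    [t >= 3]; when [t = 2] a degree count excludes the full subgeometry, and [X <= q + 2 <= Q].
    Summing [(X - 1) (Q - X) >= - Q [X = 0]] over all nonzero pairs shows that [X = 0] for more
    pairs than those with [a = 0] or [b = 0]. *)
Require Import Defs.
From HB Require Import structures.
From mathcomp Require Import all_boot all_order all_algebra all_field.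
From mathcomp Require Import ring zify.

Set Implicit Arguments.
Unset Strict Implicit.
Unset Printing Implicit Defensive.

Import GRing.Theory.

(** * Numerical inequalities for the eigenpoint bound and the moment comparison *)

Lemma leq_pencil q n : 1 < q -> n <= q -> n + 1 <= q ^ 2.
Proof.
move=> q1 nq; rewrite -mulnn (leq_trans (n := 2 * q)) ?leq_mul2r ?q1 ?orbT //; lia.
Qed.

(** Here [l * m + n + 1] bounds the number of eigenpoints when eigenvectors [y1], [y2], [y3] form a
    basis: [l * m] for those off the line through [y2] and [y3], [n] for those on it other than
    [y3], and [1] for [y3] itself. *)
Lemma leq_frame_cube q l m n : 1 < q -> l <= q -> m <= q -> n <= q -> l * m + n + 1 <= q ^ 3.
Proof.
move=> q1 lq mq nq; have : l * m <= q * q by rewrite leq_mul.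
have : 2 * q <= q * q by rewrite leq_mul2r q1 orbT.
have : 2 * (q * q) <= q * (q * q) by rewrite leq_mul2r q1 orbT.
rewrite !expnS expn0 muln1; lia.
Qed.

Lemma leq_frame_square q l m n : 1 < q -> l <= q -> m <= q -> n <= q ->
  [|| (l <= 1) && (m <= 1), (l <= 1) && (n <= 1) | (m <= 1) && (n <= 1)] ->
  l * m + n + 1 <= q ^ 2.
Proof.
move=> q1 lq mq nq h; have q2 : q + 2 <= q ^ 2.
  rewrite -mulnn (leq_trans (n := 2 * q)) ?leq_mul2r ?q1 ?orbT //; lia.
apply: leq_trans q2; case/or3P: h => /andP[h h'].
- have : l * m <= 1 * 1 by rewrite leq_mul. lia.
- have : l * m <= 1 * q by rewrite leq_mul. lia.
have : l * m <= q * 1 by rewrite leq_mul. lia.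
Qed.

(** If [r < q], the left side is at most [r^2 + r + 1 <= (r + 1)^2]. If [r = q], the product
    hypothesis forces [4 <= l * m <= q], so the left side is at most [2 q + 1], while
    [4 q <= q^2]. *)
Lemma leq_homology_square q l m n r : 1 < l -> 1 < m -> r <= q -> l <= r -> m <= r -> n <= r ->
  r * l * m <= q ^ 2 -> l * m + n + 1 <= q ^ 2.
Proof.
move=> l1 m1 rq lr mr nr; rewrite -mulnn => le.
have [rq'|qr] := ltnP r q.
  have : l * m <= r * r by rewrite leq_mul.
  have : r.+1 * r.+1 <= q * q by rewrite leq_mul.
  lia.
have {qr} rE : r = q by apply/eqP; rewrite eqn_leq rq.
have {}le : l * m <= q by move: le; rewrite rE -mulnA leq_pmul2l //; lia.
have : 2 * 2 <= l * m by rewrite leq_mul.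
have : 4 <= q -> 4 * q <= q * q by rewrite leq_mul2r => ->; rewrite orbT.
lia.
Qed.

(* [(Z - c) (c Q - Z) >= 0], arranged without subtraction. *)
Lemma quad_window c Q Z : c <= Z -> Z <= c * Q -> Z ^ 2 + c ^ 2 * Q <= (c + c * Q) * Z.
Proof.
move=> cZ ZQ.
have [u Zu] : exists u, Z = c + u by exists (Z - c); rewrite subnKC.
have [v Qv] : exists v, c * Q = Z + v by exists (c * Q - Z); rewrite subnKC.
have -> : c ^ 2 * Q = c * (c * Q) by rewrite -mulnn mulnA.
rewrite Qv Zu -mulnn; lia.
Qed.

(* The two sides differ by at least [c^2 (Q^3 - 1) Q (Q - 1)]. *)
Lemma moment_gap Q s0 s1 s2 (c := Q.-1) (e := (Q ^ 3).-1) : 1 < Q ->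
  s0 <= 2 * e -> e + s1 = e * Q ^ 4 ->
  e ^ 2 + s2 = c * (e * Q ^ 4) + e * (Q ^ 3 - Q) * Q ^ 2 ->
  c ^ 2 * Q * s0 + (c + c * Q) * s1 < s2 + c ^ 2 * Q * (Q ^ 6).-1.
Proof.
move=> Q1 h0 h1 h2.
(* Writing [Q = d + 2] and [Q^3 = d3 + 1] removes truncated subtraction; what remains is
   polynomial. *)
have [d QE] : exists d, Q = d.+2 by exists (Q - 2); lia.
have cE : c = d.+1 by rewrite /c QE.
have [d3 [Q3 d3E]] : exists d3, Q ^ 3 = d3.+1 /\ d3 = d.+1 * (d.+2 * d.+2 + d.+2 + 1).
  by eexists; split; last reflexivity; rewrite QE !expnS expn0; lia.
have eE : e = d3 by rewrite /e Q3.
have Q6 : (Q ^ 6).-1 = d3 * d3 + 2 * d3 by rewrite (expnM Q 3 2) Q3 -mulnn; lia.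
have s1E : s1 = e * (Q ^ 4).-1.
  have : 0 < Q ^ 4 by rewrite expn_gt0 QE.
  move: h1; case: (Q ^ 4) => //= n; rewrite mulnS; lia.
have {}h0 : c ^ 2 * Q * s0 <= c ^ 2 * Q * (2 * e) by rewrite leq_mul2l h0 orbT.
apply: leq_ltn_trans (leq_add h0 (leqnn _)) _.
have Q3Q : Q ^ 3 - Q = d.+2 * d.+1 * d.+3 by rewrite Q3 d3E QE; lia.
have Q4 : (Q ^ 4).-1 = d.+1 * d.+3 * (d.+2 * d.+2 + 1) by rewrite QE !expnS expn0; lia.
have -> : s2 = c * (e * (Q ^ 4).-1) + e * (d.+2 * d.+1 * d.+3 * (d.+1 * d.+3)).
  have : Q ^ 4 = ((Q ^ 4).-1).+1 by rewrite prednK // expn_gt0 QE.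
  move: h2; rewrite Q3Q; move: (Q ^ 4).-1 => n h2 nE.
  move: h2; rewrite nE cE eE d3E QE -!mulnn; lia.
rewrite s1E Q6 Q4 cE eE d3E QE -!mulnn; lia.
Qed.

Local Open Scope ring_scope.

(** * Counting tools and the map [f] *)

Lemma card_roots_lt (R : finIdomainType) (p : {poly R}) (A : {set R}) :
  p != 0 -> {in A, forall x, root p x} -> (#|A| < size p)%N.
Proof.
move=> p0 rA; rewrite cardE; apply: max_poly_roots (enum_uniq _) => //.
by apply/allP => x; rewrite mem_enum; apply: rA.
Qed.

Lemma sum_card_relC (I J : finType) (A : pred J) (r : I -> J -> bool) :
  (\sum_i #|[set j | A j && r i j]| = \sum_(j | A j) #|[set i | r i j]|)%N.
Proof.
under eq_bigr do rewrite -sum1dep_card big_mkcondr /=.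
by rewrite exchange_big; apply: eq_bigr => j _; rewrite -big_mkcond sum1dep_card.
Qed.

(** The map [f] for [i = 1]. The general coefficient ring lets it be used both on a finite field [E]
    and on the extension [L]. *)
Definition twoterm (R : pzSemiRingType) (q t : nat) (a b x : R) : R :=
  a * x ^+ q + b * x ^+ (q ^ (2 * t + 1)).

(** * Eigenvectors of [f] on a field of order [Q^3], and their first two moments *)

Section Eigenpoints.

Variables (E : finFieldType) (q t : nat).
Let Q := (q ^ t)%N.
(** A plain set of fixed points; [cardk] says that [x^Q = x] has all its roots in [E], which makes
    [k] the subfield of order [Q]. *)
Let k := [set x : E | x ^+ Q == x].

Hypotheses (charq : [pchar E].-nat q) (q_gt1 : (1 < q)%N) (t_gt1 : (1 < t)%N).
Hypotheses (cardE : #|E| = (Q ^ 3)%N) (cardk : #|k| = Q).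

Implicit Types (a b c d g r x y z : E).

Local Notation twoterm := (twoterm q t).

Let charQ n : [pchar E].-nat (q ^ n)%N.
Proof. by rewrite pnatX charq. Qed.

Let charQ' : [pchar E].-nat Q. Proof. exact: charQ. Qed.

Let kE x : (x \in k) = (x ^+ Q == x). Proof. by rewrite inE. Qed.

Let k0 : 0 \in k.
Proof. by rewrite kE expr0n expn_eq0 -leqn0 leqNgt ltnW. Qed.

Let k1 : 1 \in k. Proof. by rewrite kE expr1n. Qed.

Let kD x y : x \in k -> y \in k -> x + y \in k.
Proof. by rewrite !kE exprDn_pchar // => /eqP-> /eqP->. Qed.

Let kN x : x \in k -> - x \in k.
Proof. by rewrite !kE exprNn_pchar // => /eqP->. Qed.

Let kM x y : x \in k -> y \in k -> x * y \in k.
Proof. by rewrite !kE exprMn => /eqP-> /eqP->. Qed.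

Let kV x : x \in k -> x^-1 \in k.
Proof. by rewrite !kE exprVn => /eqP->. Qed.

Let kX x n : x \in k -> x ^+ n \in k.
Proof. by rewrite !kE exprAC => /eqP->. Qed.

Let Q_gt1 : (1 < Q)%N.
Proof. by rewrite -(exp1n t) ltn_exp2r // ltnW. Qed.

Let q_gt0 : (0 < q)%N. Proof. exact: ltnW. Qed.

Lemma twotermD a b : {morph twoterm a b : x y / x + y}.
Proof. by move=> x y; rewrite /twoterm !exprDn_pchar ?charQ // !mulrDr addrACA. Qed.

Let exp2t1 x : x ^+ (q ^ (2 * t + 1)) = x ^+ Q ^+ Q ^+ q.
Proof.
rewrite -!exprM mulnA /Q -expnD -expnSr addn1.
by congr (_ ^+ (q ^ _)%N); rewrite mul2n addnn.
Qed.

Let exp2t1k c : c \in k -> c ^+ (q ^ (2 * t + 1)) = c ^+ q.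
Proof. by rewrite kE exp2t1 => /eqP ck; rewrite !ck. Qed.

Lemma twotermZ a b c x : c \in k -> twoterm a b (c * x) = c ^+ q * twoterm a b x.
Proof. by move=> ck; rewrite /twoterm !exprMn (exp2t1k ck); ring. Qed.

Let frob_inj x y : x ^+ q = y ^+ q -> x = y.
Proof.
move=> /eqP; rewrite -subr_eq0 -exprNn_pchar // -exprDn_pchar //.
by rewrite expf_eq0 q_gt0 subr_eq0 => /eqP.
Qed.

(** Eliminating [a] when [b] is nonzero shows that [z = y' / y] satisfies [z^(q Q^2) = z^q], hence
    [z^(Q^2) = z]. With [z^(Q^3) = z] this gives [z^Q = z]. Since [f] depends additively on
    [(a, b)], this is the injectivity of [(a, b) |-> (f y, f y')]. *)
Lemma twoterm_pair_inj y y' a b : y != 0 -> y' != 0 -> y' / y \notin k ->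
  twoterm a b y = 0 -> twoterm a b y' = 0 -> a = 0 /\ b = 0.
Proof.
move=> y0 y'0 yk h h'.
have yq : y ^+ q != 0 by rewrite expf_neq0.
have y'q : y' ^+ q != 0 by rewrite expf_neq0.
suff b0 : b = 0.
  split=> //; move: h; rewrite /twoterm b0 mul0r addr0 => /eqP.
  by rewrite mulf_eq0 (negPf yq) orbF => /eqP.
apply/eqP; apply: contraR yk => b0; rewrite kE.
have /eqP : b * (y' ^+ (q ^ (2 * t + 1)) * y ^+ q - y ^+ (q ^ (2 * t + 1)) * y' ^+ q) = 0.
  rewrite [LHS](_ : _ = twoterm a b y' * y ^+ q - twoterm a b y * y' ^+ q).
    by rewrite h h' !mul0r subrr.
  by rewrite /twoterm; ring.
rewrite mulf_eq0 (negPf b0) /= subr_eq0 => /eqP e.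
have : (y' / y) ^+ (q ^ (2 * t + 1)) = (y' / y) ^+ q.
  rewrite !expr_div_n; apply/eqP; rewrite eqr_div ?expf_neq0 //.
  by rewrite e mulrC.
rewrite exp2t1 => /frob_inj zQQ.
rewrite -[X in _ == X](expf_card (y' / y)) cardE expnS expnS expn1 exprM exprM.
by rewrite zQQ.
Qed.

(** Vectors are counted instead of points; each eigenpoint contributes [Q - 1] of them. *)
Definition eigenvectors a b := [set y | (y != 0) && (twoterm a b y / y \in k)].

Let eigP a b y : reflect (y != 0 /\ exists2 g, g \in k & twoterm a b y = g * y)
   (y \in eigenvectors a b).
Proof.
rewrite inE; apply: (iffP andP) => [[y0 yk]|[y0 [g gk e]]]; split=> //.
  by exists (twoterm a b y / y) => //; rewrite divfK.
by rewrite e mulfK.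
Qed.

(** For fixed [y != 0] and [b], the map [a |-> f y / y] is a bijection of [E], so [y] is an
    eigenvector for [Q * Q^3] pairs. *)
Lemma sum_eigenvectors :
  (\sum_(ab : E * E) #|eigenvectors ab.1 ab.2| = (Q ^ 3).-1 * Q ^ 4)%N.
Proof.
rewrite (sum_card_relC (fun y => y != 0)
  (fun ab y => twoterm ab.1 ab.2 y / y \in k)).
rewrite (eq_bigr (fun=> (Q ^ 4)%N)) => [|y y0].
  rewrite sum_nat_const; congr (_ * _)%N.
  by rewrite -cardE -(cardsC1 (0 : E)); apply: eq_card => x; rewrite !inE.
pose h (ab : E * E) := (twoterm ab.1 ab.2 y / y, ab.2).
have hI : injective h.
  move=> [a b] [a' b'] [/= e eb]; rewrite eb in e *; congr (_, _).
  move/(congr1 ( *%R^~ y)): e; rewrite !divfK // /twoterm => /addIr.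
  by move/mulIf; apply; rewrite expf_neq0.
rewrite (_ : [set x | _] = h @^-1: setX k setT); last first.
  by apply/setP => ab; rewrite !inE andbT.
by rewrite card_preimset // cardsX cardsT cardE cardk -expnS.
Qed.

Let line y := [set c * y | c in k :\ 0].

Let lineP y z : y != 0 -> (z \in line y) = (z != 0) && (z / y \in k).
Proof.
move=> y0; apply/imsetP/andP => [[c /setD1P[c0 ck] ->]|[z0 zk]].
  by rewrite mulf_neq0 // mulfK.
exists (z / y); last by rewrite divfK.
by rewrite in_setD1 zk mulf_neq0 ?invr_neq0.
Qed.

Let card_line y : y != 0 -> #|line y| = Q.-1.
Proof.
move=> y0; rewrite card_imset; last exact: mulIf.
by rewrite -cardk (cardsD1 0 k) k0.
Qed.

Let line_sub a b y : y \in eigenvectors a b -> line y \subset eigenvectors a b.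
Proof.
case/eigP=> y0 [g gk e]; apply/subsetP => _ /imsetP[c /setD1P[c0 ck] ->].
apply/eigP; split; first exact: mulf_neq0.
(* Scaling an eigenvector by [c] multiplies its eigenvalue by [c^(q - 1)], by semilinearity. *)
exists (c ^+ q.-1 * g); first by rewrite kM ?kX.
by rewrite twotermZ // e -{1}(prednK q_gt0) exprSr; ring.
Qed.

(** Ordered pairs of eigenvectors are either proportional over [k], giving [Q - 1] partners for
    each, or independent. Each of the [(Q^3 - 1) (Q^3 - Q)] independent pairs [(y, z)] occurs for
    [Q^2] choices of [(a, b)], because [(a, b) |-> (f y / y, f z / z)] is a bijection of [E * E]. *)
Lemma sum_eigenvectors2 :
  (\sum_(ab : E * E) #|eigenvectors ab.1 ab.2| ^ 2
   = Q.-1 * ((Q ^ 3).-1 * Q ^ 4) + (Q ^ 3).-1 * (Q ^ 3 - Q) * Q ^ 2)%N.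
Proof.
pose A (u : E * E) := (u.1 != 0) && ((u.2 != 0) && (u.2 / u.1 \notin k)).
pose r (ab u : E * E) := (twoterm ab.1 ab.2 u.1 / u.1 \in k)
  && (twoterm ab.1 ab.2 u.2 / u.2 \in k).
transitivity (\sum_(ab : E * E) (Q.-1 * #|eigenvectors ab.1 ab.2| +
   #|[set u | A u && r ab u]|))%N.
  apply: eq_bigr => -[a b] _ /=; set P := eigenvectors a b.
  have -> : (#|P| ^ 2 = \sum_(y in P) (#|line y| + #|P :\: line y|))%N.
    rewrite (eq_bigr (fun=> #|P|)) ?sum_nat_const // => y yP.
    by rewrite -(cardsID (line y) P) (setIidPr (line_sub yP)).
  rewrite big_split /=; congr (_ + _)%N.
    rewrite (eq_bigr (fun=> Q.-1)) ?sum_nat_const 1?mulnC // => y.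
    by case/eigP => y0 _; rewrite card_line.
  rewrite -sum1dep_card (eq_bigl (fun u : E * E => (u.1 \in P) && (u.2 \in P :\: line u.1))).
    rewrite -(pair_big_dep (mem P) (fun y => mem (P :\: line y)) (fun _ _ => 1%N)) /=.
    by apply: eq_bigr => y _; rewrite sum1_card.
  move=> [y z] /=; rewrite /A /r /= in_setD.
  have [->|y0] := eqVneq y 0; first by rewrite [in RHS]inE eqxx.
  rewrite lineP // ![_ \in P]inE y0 /=.
  by case: (z != 0) => /=; rewrite ?andbF //= andbCA.
rewrite big_split /= -big_distrr sum_eigenvectors /=; congr (_ + _)%N.
rewrite (sum_card_relC A r) (eq_bigr (fun=> (Q ^ 2)%N)) => [|[y z] /and3P[/= y0 z0 zy]].
  rewrite sum_nat_const; congr (_ * _)%N.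
  rewrite -sum1_card (eq_bigl (fun u : E * E => (u.1 != 0) && (u.2 \in ~: [set c * u.1 | c in k]))).
    rewrite -(pair_big_dep (fun y => y != 0) (fun y => mem (~: [set c * y | c in k]))
      (fun _ _ => 1%N)) /=.
    rewrite (eq_bigr (fun=> (Q ^ 3 - Q)%N)) => [|y y0].
      rewrite sum_nat_const -cardE -(cardsC1 (0 : E)); congr (_ * _)%N.
      by apply: eq_card => x; rewrite !inE.
    rewrite sum1_card cardsCs setCK card_imset ?cardE ?cardk //; exact: mulIf.
  move=> [y z]; rewrite [in LHS]/in_mem /= /A /=; case: (eqVneq y 0) => //= y0.
  rewrite in_setC; have -> : (z \in [set c * y | c in k]) = (z / y \in k).
    apply/imsetP/idP => [[c ck ->]|zk]; first by rewrite mulfK.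
    by exists (z / y) => //; rewrite divfK.
  by case: (eqVneq z 0) => //= ->; rewrite mul0r k0.
pose h (ab : E * E) := (twoterm ab.1 ab.2 y / y, twoterm ab.1 ab.2 z / z).
have hI : injective h.
  move=> [a b] [a' b'] [/= ey ez].
  have tB u : twoterm (a - a') (b - b') u = twoterm a b u - twoterm a' b' u.
    by rewrite /twoterm; ring.
  have [] := twoterm_pair_inj (a := a - a') (b := b - b') y0 z0 zy.
  - by rewrite tB -(divfK y0 (twoterm a b y)) ey divfK ?subrr.
  - by rewrite tB -(divfK z0 (twoterm a b z)) ez divfK ?subrr.
  by move=> /eqP; rewrite subr_eq0 => /eqP-> /eqP; rewrite subr_eq0 => /eqP->.
rewrite (_ : [set x | _] = h @^-1: setX k k).
  by rewrite card_preimset // cardsX cardk mulnn.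
by apply/setP => ab; rewrite [LHS]in_set [RHS]in_set in_setX.
Qed.

(** * Upper bound for the number of eigenpoints *)

(* If [y] has eigenvalue [g] then [r y] has eigenvalue [d] exactly when [r] is a nonzero element of
   [ratios g d]. *)
Let ratios g d := [set r in k | r ^+ q * g == d * r].

Let card_ratios g d : (g != 0) || (d != 0) -> (#|ratios g d| <= q)%N.
Proof.
move=> gd; pose p := g *: 'X^q - d *: 'X : {poly E}.
have p0 : p != 0.
  apply: contraTneq gd => /polyP pE; rewrite negb_or !negbK.
  have := pE q; have := pE 1%N; rewrite /p !coefE eqxx (gtn_eqF q_gt1) (ltn_eqF q_gt1).
  by rewrite !mulr0 !mulr1 subr0 sub0r => /eqP; rewrite oppr_eq0 => -> ->; rewrite eqxx.
have sp : (size p <= q.+1)%N.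
  rewrite (leq_trans (size_polyD _ _)) // size_polyN geq_max.
  apply/andP; split; apply: leq_trans (size_scale_leq _ _) _.
    by rewrite size_polyXn.
  by rewrite size_polyX ltnW.
rewrite -ltnS (leq_trans _ sp) //; apply: card_roots_lt => // r /setIdP[_ /eqP e].
by rewrite /root /p !hornerE -e subr_eq0 mulrC.
Qed.

(** With [ratios_mul]: being linked by a nonzero ratio is a symmetric and transitive relation on
    eigenvalues. *)
Let ratios_inv g d r : r != 0 -> r \in ratios g d -> r^-1 \in ratios d g.
Proof.
move=> r0 /setIdP[rk /eqP e]; rewrite in_set kV //= exprVn; apply/eqP.
have rq : r ^+ q != 0 by rewrite expf_neq0.
apply: (mulfI rq); rewrite mulrA mulfV // mul1r mulrA e.
by rewrite mulfK.
Qed.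

Let ratios_mul g d e r s :
  r \in ratios g d -> s \in ratios d e -> r * s \in ratios g e.
Proof.
move=> /setIdP[rk /eqP er] /setIdP[sk /eqP es]; rewrite in_set kM //=.
apply/eqP; transitivity (s ^+ q * (r ^+ q * g)); first by rewrite exprMn; ring.
by rewrite er [LHS]mulrA es; ring.
Qed.

(** [0] always lies in [ratios g d], so a second element is a nonzero one. *)
Let ratios_gt1P g d :
  reflect (exists2 r, r != 0 & r \in ratios g d) (1 < #|ratios g d|)%N.
Proof.
have r0 : 0 \in ratios g d by rewrite in_set k0 expr0n eqn0Ngt q_gt0 mul0r mulr0 eqxx.
rewrite (cardsD1 0) r0 ltnS card_gt0; apply: (iffP (set0Pn _)) => -[r].
  by case/setD1P; exists r.
by move=> *; exists r; apply/setD1P.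
Qed.

Let plane y1 y2 := [set u.1 * y1 + u.2 * y2 | u in setX k k].

Section Independent.

Variables (a b y1 y2 : E).
Hypotheses (y1_neq0 : y1 != 0) (y2_notin : y2 / y1 \notin k).

Let free2 c1 c2 : c1 \in k -> c2 \in k -> c1 * y1 + c2 * y2 = 0 -> c1 = 0 /\ c2 = 0.
Proof.
move=> c1k c2k e; suff c20 : c2 = 0.
  split=> //; move/eqP: e; rewrite c20 mul0r addr0 mulf_eq0 (negPf y1_neq0) orbF.
  by move/eqP.
apply/eqP; apply: contraR y2_notin => c20.
rewrite (_ : y2 / y1 = - c1 / c2) ?kM ?kN ?kV //.
by apply/eqP; rewrite eqr_div // mulNr -subr_eq0 opprK [X in X == _](_ : _ = 0) // -e; ring.
Qed.

Let free3 y3 c1 c2 c3 : y3 \notin plane y1 y2 -> c1 \in k -> c2 \in k -> c3 \in k ->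
  c1 * y1 + c2 * y2 + c3 * y3 = 0 -> [/\ c1 = 0, c2 = 0 & c3 = 0].
Proof.
move=> y3p c1k c2k c3k e; suff c30 : c3 = 0.
  by rewrite c30 mul0r addr0 in e; have [] := free2 c1k c2k e.
apply/eqP; apply: contraR y3p => c30; apply/imsetP.
exists (- c1 / c3, - c2 / c3); first by rewrite in_setX /= !kM ?kN ?kV.
apply: (mulfI c30); transitivity (- (c1 * y1 + c2 * y2)); last by rewrite /=; field.
by apply/eqP; rewrite -subr_eq0 opprK addrC e.
Qed.

(** The combination map from [k^3] is injective and [#|E| = Q^3], so it is onto. *)
Let span3 y3 y : y3 \notin plane y1 y2 -> exists c : E * E * E,
  [/\ c.1.1 \in k, c.1.2 \in k, c.2 \in k & y = c.1.1 * y1 + c.1.2 * y2 + c.2 * y3].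
Proof.
move=> y3p; pose h (c : E * E * E) := c.1.1 * y1 + c.1.2 * y2 + c.2 * y3.
pose D := setX (setX k k) k.
have hI : {in D &, injective h}.
  move=> [[c1 c2] c3] [[d1 d2] d3].
  rewrite !in_setX => /andP[/andP[/= ? ?] ?] /andP[/andP[/= ? ?] ?] e.
  have [||||] := @free3 y3 (c1 - d1) (c2 - d2) (c3 - d3) y3p; try by rewrite kD ?kN.
    by move/eqP: e; rewrite -subr_eq0 => /eqP <-; rewrite /h /=; ring.
  by do 3![move/eqP; rewrite subr_eq0 => /eqP ->].
have : y \in h @: D.
  have -> : h @: D = setT.
    apply/eqP; rewrite eqEcard subsetT cardsT cardE card_in_imset //.
    by rewrite !cardsX cardk mulnn -expnSr /=.
  by rewrite inE.
case/imsetP=> -[[c1 c2] c3]; rewrite !in_setX => /andP[/andP[/= ? ?] ?] ->.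
by exists (c1, c2, c3).
Qed.

Variables (g1 g2 : E).
Hypotheses (g1k : g1 \in k) (g2k : g2 \in k).
Hypotheses (e1 : twoterm a b y1 = g1 * y1) (e2 : twoterm a b y2 = g2 * y2).

(** [c] and [d] are coordinates of one eigenvector of eigenvalue [h] along eigenvectors of
    eigenvalues [g] and [g']; dividing the two equations eliminates [h]. *)
Let ratio_of c d g g' h : c != 0 -> c \in k -> d \in k ->
  c ^+ q * g = h * c -> d ^+ q * g' = h * d -> d / c \in ratios g' g.
Proof.
move=> c0 ck dk ec ed; rewrite in_set kM ?kV //=.
have cq : c ^+ q != 0 by rewrite expf_neq0.
apply/eqP; apply: (mulfI cq); rewrite expr_div_n.
transitivity (h * d); first by rewrite -ed; field.
by rewrite [RHS]mulrA ec; field.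
Qed.

Let eig_coord3 y3 g3 c1 c2 c3 g : y3 \notin plane y1 y2 -> twoterm a b y3 = g3 * y3 ->
  g3 \in k -> c1 \in k -> c2 \in k -> c3 \in k -> g \in k ->
  twoterm a b (c1 * y1 + c2 * y2 + c3 * y3) = g * (c1 * y1 + c2 * y2 + c3 * y3) ->
  [/\ c1 ^+ q * g1 = g * c1, c2 ^+ q * g2 = g * c2 & c3 ^+ q * g3 = g * c3].
Proof.
move=> y3p e3 g3k c1k c2k c3k gk; rewrite !twotermD !twotermZ // e1 e2 e3 => e.
have [||||] := @free3 y3 (c1 ^+ q * g1 - g * c1) (c2 ^+ q * g2 - g * c2)
  (c3 ^+ q * g3 - g * c3) y3p; try by rewrite kD ?kN ?kM ?kX.
  by move/eqP: e; rewrite -subr_eq0 => /eqP <-; ring.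
by do 3![move/eqP; rewrite subr_eq0 => /eqP ->].
Qed.

Let eig_coord2 c1 c2 g : c1 \in k -> c2 \in k -> g \in k ->
  twoterm a b (c1 * y1 + c2 * y2) = g * (c1 * y1 + c2 * y2) ->
  c1 ^+ q * g1 = g * c1 /\ c2 ^+ q * g2 = g * c2.
Proof.
move=> c1k c2k gk; rewrite !twotermD !twotermZ // e1 e2 => e.
have [|||] := @free2 (c1 ^+ q * g1 - g * c1) (c2 ^+ q * g2 - g * c2);
   try by rewrite kD ?kN ?kM ?kX.
  by move/eqP: e; rewrite -subr_eq0 => /eqP <-; ring.
by do 2![move/eqP; rewrite subr_eq0 => /eqP ->].
Qed.

Let cardk0 : #|k :\ 0| = Q.-1.
Proof. by rewrite -cardk (cardsD1 0 k) k0. Qed.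

(** Normalising the first nonzero coordinate to [1] leaves the points [y1 + r y2], with [r] in
    [ratios g2 g1], and the point [y2]. *)
Lemma card_eigenvectors_plane : eigenvectors a b \subset plane y1 y2 ->
  (#|eigenvectors a b| <= Q.-1 * (#|ratios g2 g1| + 1))%N.
Proof.
move=> sub.
pose A := [set u.1 * (y1 + u.2 * y2) | u in setX (k :\ 0) (ratios g2 g1)].
have : eigenvectors a b \subset A :|: line y2.
  apply/subsetP => y yP; have /imsetP[[c1 c2]] := subsetP sub y yP.
  rewrite in_setX => /andP[/= c1k c2k] yE; case/eigP: yP => y0 [g gk].
  rewrite yE in y0 *; case/eig_coord2 => // h1 h2; rewrite in_setU.
  have [c10|c10] := eqVneq c1 0.
    apply/orP; right; apply/imsetP; exists c2; last by rewrite c10; ring.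
    by rewrite in_setD1 c2k andbT; apply: contraNneq y0 => ->; rewrite c10 !mul0r addr0.
  apply/orP; left; apply/imsetP; exists (c1, c2 / c1).
    by rewrite in_setX in_setD1 c10 c1k (ratio_of _ _ _ h1 h2).
  by rewrite /=; field.
move/subset_leq_card/leq_trans; apply.
rewrite (leq_trans (leq_card_setU _ _)) // mulnDr muln1 leq_add //.
  by rewrite (leq_trans (leq_imset_card _ _)) // cardsX cardk0.
by rewrite (leq_trans (leq_imset_card _ _)) // cardk0.
Qed.

(** The same normalisation gives the points [y1 + r y2 + s y3], [y2 + r y3] and [y3], with [r] and
    [s] in the corresponding sets of ratios. *)
Lemma card_eigenvectors_frame y3 g3 : y3 \notin plane y1 y2 -> g3 \in k ->
  twoterm a b y3 = g3 * y3 ->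
  (#|eigenvectors a b| <=
     Q.-1 * (#|ratios g2 g1| * #|ratios g3 g1| + #|ratios g3 g2| + 1))%N.
Proof.
move=> y3p g3k e3.
pose A := [set u.1 * (y1 + u.2.1 * y2 + u.2.2 * y3) |
   u in setX (k :\ 0) (setX (ratios g2 g1) (ratios g3 g1))].
pose B := [set u.1 * (y2 + u.2 * y3) | u in setX (k :\ 0) (ratios g3 g2)].
have : eigenvectors a b \subset A :|: B :|: line y3.
  apply/subsetP => y; case/eigP=> y0 [g gk].
  have [[[c1 c2] c3] [/= c1k c2k c3k yE]] := span3 y y3p.
  rewrite yE in y0 *; case/(eig_coord3 y3p e3) => // h1 h2 h3; rewrite !in_setU.
  have [c10|c10] := eqVneq c1 0; last first.
    apply/orP; left; apply/orP; left; apply/imsetP; exists (c1, (c2 / c1, c3 / c1)).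
      by rewrite !in_setX in_setD1 c10 c1k (ratio_of _ _ _ h1 h2) // (ratio_of _ _ _ h1 h3).
    by rewrite /=; field.
  have [c20|c20] := eqVneq c2 0; last first.
    apply/orP; left; apply/orP; right; apply/imsetP; exists (c2, c3 / c2).
      by rewrite !in_setX in_setD1 c20 c2k (ratio_of _ _ _ h2 h3).
    by rewrite /= c10; field.
  apply/orP; right; apply/imsetP; exists c3; last by rewrite c10 c20; ring.
  by rewrite in_setD1 c3k andbT; apply: contraNneq y0 => ->; rewrite c10 c20 !mul0r !addr0.
move/subset_leq_card/leq_trans; apply.
rewrite !(leq_trans (leq_card_setU _ _)) // !mulnDr muln1 !leq_add //.
- rewrite (leq_trans (leq_card_setU _ _)) // leq_add //;
    by rewrite (leq_trans (leq_imset_card _ _)) // !cardsX cardk0.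
by rewrite (leq_trans (leq_imset_card _ _)) // cardk0.
Qed.

(** Each basis vector [yi] may be scaled by any element of [ratios gi g1], and the sums of the
    results still solve [f x = g1 x]. For [t = 2] this plays against the degree bound [q^2]. *)
Lemma card_eigenspace_frame y3 g3 : y3 \notin plane y1 y2 -> twoterm a b y3 = g3 * y3 ->
  (#|ratios g1 g1| * #|ratios g2 g1| * #|ratios g3 g1|
     <= #|[set x | twoterm a b x == g1 * x]%R|)%N.
Proof.
move=> y3p e3; pose h (c : E * E * E) := c.1.1 * y1 + c.1.2 * y2 + c.2 * y3.
pose D := setX (setX (ratios g1 g1) (ratios g2 g1)) (ratios g3 g1).
rewrite -!cardsX -/D -(@card_in_imset _ _ h).
  apply/subset_leq_card/subsetP => _ /imsetP[[[c1 c2] c3] cD ->].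
  move: cD; rewrite !in_setX => /andP[/andP[/=]].
  move=> /setIdP[c1k /eqP h1] /setIdP[c2k /eqP h2] /setIdP[c3k /eqP h3].
  by rewrite inE /h /= !twotermD !twotermZ // e1 e2 e3 !mulrA h1 h2 h3 !mulrDr !mulrA.
move=> [[c1 c2] c3] [[d1 d2] d3]; rewrite !in_setX.
case/andP=> /andP[/= /setIdP[? _] /setIdP[? _]] /setIdP[? _].
case/andP=> /andP[/= /setIdP[? _] /setIdP[? _]] /setIdP[? _] e.
have [||||] := @free3 y3 (c1 - d1) (c2 - d2) (c3 - d3) y3p; try by rewrite kD ?kN.
  by move/eqP: e; rewrite -subr_eq0 => /eqP <-; rewrite /h /=; ring.
by do 3![move/eqP; rewrite subr_eq0 => /eqP ->].
Qed.

End Independent.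

(* The [q]-th power of [a x^q + b x^(q^5) = g x] has degree [q^2] in [x], because [x^(q^6) = x]. *)
Lemma card_eigenspace_t2 a b g : t = 2 -> (a != 0) || (b != 0) ->
  (#|[set x | twoterm a b x == g * x]%R| <= q ^ 2)%N.
Proof.
move=> t2 ab0.
pose p := a ^+ q *: 'X^(q ^ 2) - g ^+ q *: 'X^q + b ^+ q *: 'X^1 : {poly E}.
have q2 : (q < q ^ 2)%N by rewrite -{1}(expn1 q) ltn_exp2l.
have p0 : p != 0.
  apply: contraTneq ab0 => /polyP pE; rewrite negb_or !negbK.
  have := pE (q ^ 2)%N; have := pE 1%N; rewrite /p !coefE eqxx.
  rewrite (ltn_eqF (ltn_trans q_gt1 q2)) (ltn_eqF q_gt1) (gtn_eqF q2)
    (gtn_eqF (ltn_trans q_gt1 q2)).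
  rewrite !mulr0 !mulr1 !subr0 !addr0 add0r => /eqP; rewrite expf_eq0 q_gt0 /= => ->.
  by rewrite eqxx mulr1 => /eqP; rewrite expf_eq0 q_gt0 /= => ->.
have sp : (size p <= (q ^ 2).+1)%N.
  have sX n c : (n <= q ^ 2)%N -> (size (c *: 'X^n : {poly E}) <= (q ^ 2).+1)%N.
    by move=> nq; apply: leq_trans (size_scale_leq _ _) _; rewrite size_polyXn.
  apply: leq_trans (size_polyD _ _) _; rewrite geq_max [X in _ && X]sX ?andbT; last first.
    exact: leq_trans q2.
  apply: leq_trans (size_polyD _ _) _; rewrite size_polyN geq_max.
  by rewrite !sX // ltnW.
rewrite -ltnS (leq_trans _ sp) //; apply: card_roots_lt => // x.
rewrite inE => /eqP /(congr1 (fun z => z ^+ q)).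
rewrite /twoterm exprDn_pchar // !exprMn -!exprM mulnn t2.
rewrite [(_ * q)%N](_ : _ = #|E|) ?expf_card => [e|]; last first.
  by rewrite cardE /Q t2 -expnSr -expnM.
rewrite /root /p !hornerE; apply/eqP; move: e => /eqP; rewrite -subr_eq0 => /eqP <-.
by ring.
Qed.

(** Multiplication by [r * s] injects the first set into the second. *)
Let ratios_leq g d g' d' r s : r != 0 -> s != 0 -> r \in ratios g' g -> s \in ratios d d' ->
  (#|ratios g d| <= #|ratios g' d'|)%N.
Proof.
move=> r0 s0 rR sR; rewrite -(card_imset _ (mulfI (mulf_neq0 r0 s0))).
apply/subset_leq_card/subsetP => _ /imsetP[u uR ->].
by rewrite mulrAC; apply: ratios_mul sR; apply: ratios_mul rR uR.
Qed.

Lemma card_eigenvectors a b : (a != 0) || (b != 0) ->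
  (#|eigenvectors a b| <= Q.-1 * Q)%N.
Proof.
move=> ab0; have qQ : (q ^ 2 <= Q)%N by rewrite leq_exp2l.
set P := eigenvectors a b.
(* Two independent eigenvectors cannot both be killed by a nonzero [f]; this is what makes
   [card_ratios] applicable. *)
have pairP y z g h : y != 0 -> z != 0 -> z / y \notin k -> twoterm a b y = g * y ->
    twoterm a b z = h * z -> (g != 0) || (h != 0).
  move=> y0 z0 zy ey ez; apply: contraTT ab0; rewrite !negb_or !negbK => /andP[/eqP g0 /eqP h0].
  have [|| -> ->] := twoterm_pair_inj (a := a) (b := b) y0 z0 zy; last by rewrite eqxx.
    by rewrite ey g0 mul0r.
  by rewrite ez h0 mul0r.
have [->|/set0Pn[y1 y1P]] := eqVneq P set0; first by rewrite cards0.
have [y10 [g1 g1k e1]] := eigP _ _ _ y1P.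
have [sub1|/subsetPn[y2 y2P y2n]] := boolP (P \subset line y1).
  rewrite (leq_trans (subset_leq_card sub1)) // card_line //.
  by rewrite leq_pmulr // ltnW.
have [y20 [g2 g2k e2]] := eigP _ _ _ y2P.
have y21 : y2 / y1 \notin k by move: y2n; rewrite lineP // y20.
have g21 := pairP _ _ _ _ y10 y20 y21 e1 e2.
have n21 : (#|ratios g2 g1| <= q)%N by rewrite card_ratios // orbC.
have [sub2|/subsetPn[y3 y3P y3n]] := boolP (P \subset plane y1 y2).
  apply: leq_trans (card_eigenvectors_plane y10 y21 g1k g2k e1 e2 sub2) _.
  rewrite leq_mul2l; apply/orP; right.
  exact: leq_trans (leq_pencil q_gt1 n21) qQ.
have [y30 [g3 g3k e3]] := eigP _ _ _ y3P.
have y31 : y3 / y1 \notin k.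
  apply: contraNN y3n => h; apply/imsetP; exists (y3 / y1, 0); first by rewrite in_setX h k0.
  by rewrite /= divfK // mul0r addr0.
have y32 : y3 / y2 \notin k.
  apply: contraNN y3n => h; apply/imsetP; exists (0, y3 / y2); first by rewrite in_setX h k0.
  by rewrite /= divfK // mul0r add0r.
have n31 : (#|ratios g3 g1| <= q)%N.
  by rewrite card_ratios // orbC (pairP _ _ _ _ y10 y30 y31 e1 e3).
have n32 : (#|ratios g3 g2| <= q)%N.
  by rewrite card_ratios // orbC (pairP _ _ _ _ y20 y30 y32 e2 e3).
apply: leq_trans (card_eigenvectors_frame y10 y21 g1k g2k e1 e2 y3n g3k e3) _.
rewrite leq_mul2l; apply/orP; right.
(* For [t >= 3] the crude bound [q^2 + q + 1 <= q^3] is enough. *)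
have [t2|t_gt2] := leqP t 2; last first.
  have : (q ^ 3 <= Q)%N by rewrite leq_exp2l.
  exact/leq_trans/leq_frame_cube.
have {t2} t2 : t = 2 by apply/eqP; rewrite eqn_leq t2.
apply: leq_trans qQ.
(* Linkage being an equivalence, either at least two of the three sets of ratios reduce to [0],
   which leaves at most [q + 2] points, or all three eigenvalues are linked. *)
have [/ratios_gt1P[r2 r20 r2R]|] := boolP (1 < #|ratios g2 g1|)%N; last first.
  rewrite -leqNgt => n21'.
  have [/ratios_gt1P[r3 r30 r3R]|] := boolP (1 < #|ratios g3 g1|)%N; last first.
    by rewrite -leqNgt => n31'; apply: leq_frame_square; rewrite ?n21' ?n31'.
  suff n32' : (#|ratios g3 g2| <= 1)%N.
    by apply: leq_frame_square; rewrite ?n21' ?n32' ?orbT.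
  rewrite leqNgt; apply: contraL n21' => /ratios_gt1P[r r0 rR].
  rewrite -ltnNge; apply/ratios_gt1P; exists (r^-1 * r3).
    by rewrite mulf_neq0 ?invr_neq0.
  by apply: ratios_mul r3R; apply: ratios_inv.
have n21' : (1 < #|ratios g2 g1|)%N by apply/ratios_gt1P; exists r2.
have [/ratios_gt1P[r3 r30 r3R]|] := boolP (1 < #|ratios g3 g1|)%N; last first.
  rewrite -leqNgt => n31'.
  suff n32' : (#|ratios g3 g2| <= 1)%N.
    by apply: leq_frame_square; rewrite ?n31' ?n32' ?orbT.
  rewrite leqNgt; apply: contraL n31' => /ratios_gt1P[r r0 rR].
  rewrite -ltnNge; apply/ratios_gt1P.
  by exists (r * r2); [rewrite mulf_neq0 | apply: ratios_mul rR r2R].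
have n31' : (1 < #|ratios g3 g1|)%N by apply/ratios_gt1P; exists r3.
have g10 : g1 != 0.
  apply: contraTneq r2R => g1E; apply/negP => /setIdP[_].
  by move: g21; rewrite g1E eqxx mul0r mulf_eq0 expf_eq0 (negPf r20) andbF => /negPf->.
have n11 : (#|ratios g1 g1| <= q)%N by rewrite card_ratios // g10.
have ri2 : r2^-1 \in ratios g1 g2 by apply: ratios_inv.
have ri3 : r3^-1 \in ratios g1 g3 by apply: ratios_inv.
have [r2V r3V] : r2^-1 != 0 /\ r3^-1 != 0 by rewrite !invr_neq0.
(* All three eigenvalues are now linked, so every set of ratios is at most as large as
   [ratios g1 g1]. *)
have one1 : 1 \in ratios g1 g1 by rewrite in_set k1 expr1n mul1r mulr1 eqxx.
have m21 := ratios_leq r2V (oner_neq0 _) ri2 one1.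
have m31 := ratios_leq r3V (oner_neq0 _) ri3 one1.
have m32 := ratios_leq r3V r20 ri3 r2R.
apply: leq_homology_square n21' n31' n11 m21 m31 m32 _.
exact: leq_trans (card_eigenspace_frame y10 y21 e1 e2 y3n e3)
  (card_eigenspace_t2 g1 t2 ab0).
Qed.

(** * Existence of a map without eigenvectors *)

Lemma card_eigenvectors_ge a b : eigenvectors a b != set0 ->
  (Q.-1 <= #|eigenvectors a b|)%N.
Proof.
case/set0Pn=> y yP; have [y0 _] := eigP _ _ _ yP.
by rewrite -(card_line y0) subset_leq_card ?line_sub.
Qed.

Lemma exists_no_eigenvector : exists a b,
  [/\ a != 0, b != 0 & forall x g, x != 0 -> g ^+ Q = g -> twoterm a b x <> g * x].
Proof.
have [[a b] /and3P[/= a0 b0 /eqP P0]|none] :=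
    pickP [pred ab : E * E | [&& ab.1 != 0, ab.2 != 0 & eigenvectors ab.1 ab.2 == set0]].
  exists a, b; split=> // x g x0 gk e; have : x \in eigenvectors a b.
    by apply/eigP; split=> //; exists g; rewrite // kE gk.
  by rewrite P0 inE.
(* Now every pair with [Z = 0] has [a = 0] or [b = 0]. The pair [o] is set aside: for the zero map
   all [e] nonzero vectors are eigenvectors. *)
exfalso; pose Z (ab : E * E) := #|eigenvectors ab.1 ab.2|; pose o : E * E := (0, 0).
pose e := (Q ^ 3).-1; pose c := Q.-1.
have Zo : Z o = e.
  rewrite /Z /e -cardE -(cardsC1 (0 : E)); apply: eq_card => x.
  by rewrite !inE /twoterm /= !mul0r addr0 mul0r expr0n eqn0Ngt expn_gt0 q_gt0 eqxx andbT.
have S1 : (e + \sum_(ab | ab != o) Z ab = e * Q ^ 4)%N.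
  by rewrite -sum_eigenvectors [RHS](bigD1 o) //= -[in LHS]Zo.
have S2 : (e ^ 2 + \sum_(ab | ab != o) Z ab ^ 2 = c * (e * Q ^ 4) + e * (Q ^ 3 - Q) * Q ^ 2)%N.
  by rewrite -sum_eigenvectors2 [RHS](bigD1 o) //= -[in LHS]Zo.
have S0 : (\sum_(ab | ab != o) (Z ab == 0) <= 2 * e)%N.
  rewrite -big_mkcondr /= sum1dep_card.
  apply: (@leq_trans #|setX [set 0 : E] [set~ 0] :|: setX [set~ 0] [set 0 : E]|).
    apply/subset_leq_card/subsetP => -[a b] /setIdP[].
    rewrite /o xpair_eqE negb_and cards_eq0 => abo P0.
    have := none (a, b); rewrite /= P0 andbT !inE.
    by case: (a =P 0) abo; case: (b =P 0).
  apply: leq_trans (leq_card_setU _ _) _.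
  by rewrite !cardsX !cards1 !cardsC1 cardE /e mul1n muln1 addnn mul2n.
have cT : (\sum_(ab : E * E | ab != o) 1 = (Q ^ 6).-1)%N.
  rewrite sum1dep_card (_ : (Q ^ 6)%N = #|{: E * E}|); last by rewrite card_prod cardE -expnD.
  by rewrite -(cardsC1 o); apply: eq_card => u; rewrite !inE.
(* Where [Z = 0] both sides equal [c^2 Q]; elsewhere [c <= Z <= c Q] and [quad_window] applies. *)
have main : (\sum_(ab | ab != o) (Z ab ^ 2 + c ^ 2 * Q * 1) <=
    \sum_(ab | ab != o) (c ^ 2 * Q * (Z ab == 0%N) + (c + c * Q) * Z ab))%N.
  apply: leq_sum => -[a b] abo; rewrite muln1.
  have ab0 : (a != 0) || (b != 0) by move: abo; rewrite /o xpair_eqE negb_and.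
  have [Z0|Z0] := eqVneq (Z (a, b)) 0%N; first by rewrite Z0 muln1 !muln0 addn0.
  rewrite muln0; apply: quad_window; last exact: card_eigenvectors.
  by apply: card_eigenvectors_ge; rewrite -cards_eq0.
move: main; rewrite !big_split /= -!big_distrr /= cT leqNgt => /negP; apply.
exact: moment_gap.
Qed.

End Eigenpoints.

Lemma pnat_card_pchar (F : finFieldType) (L : fieldExtType F) : [pchar L].-nat #|F|.
Proof.
have [p pr pF] := finPcharP F.
rewrite (card_pprimeChar pF) pnatX; apply/orP; left.
by rewrite pnatE // (pchar_lalg L).
Qed.

(** * Transfer to [L], and exclusion of invariant planes *)

Section Twoterm.

Variables (F : finFieldType) (L : fieldExtType F) (t : nat) (Kt K3t : {subfield L}).
Hypotheses (ht : (1 < t)%N) (hKt : \dim Kt = t) (hK3t : \dim K3t = (3 * t)%N).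
Local Notation q := #|F|.

Lemma subfield_third : (Kt <= K3t)%VS.
Proof.
apply/subvP => x; rewrite !Fermat's_little_theorem hKt hK3t => /eqP xt.
by rewrite mulnC expnM !expnS expn0 muln1 !exprM !xt.
Qed.

Lemma exists_twoterm_no_eigenvector : exists a b : L,
  [/\ (a \in K3t) && (a != 0), (b \in K3t) && (b != 0) &
   forall x g, x \in K3t -> x != 0 -> g \in Kt ->
     twoterm q t a b x <> g * x].
Proof.
(* [K3t] becomes a finite field in its own right, in which the roots of [x^(q^t) = x] are the
   elements of [Kt]. *)
pose E := finvect_type (subvs_of K3t).
have vX (x : E) n : vsval (x ^+ n) = vsval x ^+ n by rewrite rmorphXn.
have cE : #|E| = ((q ^ t) ^ 3)%N.
  transitivity #|(fullv : {vspace E})|; first by apply: eq_card => x; rewrite memvf.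
  by rewrite card_vspace dimvf /dim /= hK3t mulnC expnM.
have ck : #|[set x : E | x ^+ (q ^ t) == x]| = (q ^ t)%N.
  pose v (x : E) : finvect_type L := vsval x.
  have vI : injective v by exact: val_inj.
  rewrite -(card_imset _ vI) -[in RHS]hKt -(card_vspace (Kt : {vspace finvect_type L})).
  apply: eq_card => y; apply/imsetP/idP => [[x]|yK].
    rewrite inE => /eqP e ->; rewrite Fermat's_little_theorem hKt /v.
    by rewrite -vX e.
  have yK3 : y \in K3t by apply: (subvP subfield_third).
  exists (Subvs yK3) => //; rewrite inE -(inj_eq vI) /v vX.
  by move: yK; rewrite Fermat's_little_theorem hKt.
have q1 : (1 < q)%N by exact: finNzRing_gt1.
have cq : [pchar E].-nat q by exact: pnat_card_pchar.
have [a [b [a0 b0 ab]]] := exists_no_eigenvector cq q1 ht cE ck.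
exists (vsval a), (vsval b); split.
- by rewrite subvsP -(inj_eq val_inj) in a0 *.
- by rewrite subvsP -(inj_eq val_inj) in b0 *.
move=> x g xK x0 gK e.
have gK3 := subvP subfield_third _ gK.
apply: (ab (Subvs xK) (Subvs gK3)).
- by rewrite -(inj_eq val_inj).
- apply: val_inj; apply: etrans (vX _ _) _; apply/eqP.
  by move: gK; rewrite Fermat's_little_theorem hKt.
apply: val_inj; apply: etrans e.
by rewrite -[LHS]/(vsval _) /twoterm rmorphD !rmorphM /= !vX.
Qed.

(** Elements of [F] are fixed by [q]-th powers. Linearity over [F] lets [linfun] turn [f] into an
    endomorphism, giving access to images, kernels and dimensions. *)
Lemma twoterm_linear (a b : L) : linear (twoterm q t a b).
Proof.
have cX (c : F) n : c ^+ (q ^ n) = c.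
  by elim: n => [|n IHn]; rewrite ?expr1 // expnS exprM expf_card.
have cn n : [pchar L].-nat (q ^ n)%N by rewrite pnatX pnat_card_pchar.
move=> c x y; rewrite /twoterm -[q in _ ^+ q]expn1 !exprDn_pchar // !exprZn !cX.
by rewrite scalerDr !scalerAr !mulrDr addrACA.
Qed.

HB.instance Definition _ (a b : L) :=
  GRing.isLinear.Build F L L *:%R (twoterm q t a b) (twoterm_linear a b).

Lemma twoterm_semilinear (a b c x : L) : c \in Kt ->
  twoterm q t a b (c * x) = c ^+ q * twoterm q t a b x.
Proof.
rewrite Fermat's_little_theorem hKt => /eqP ck; rewrite /twoterm !exprMn.
suff -> : c ^+ (q ^ (2 * t + 1)) = c ^+ q by ring.
by rewrite expnD mul2n -addnn expnD expn1 !exprM !ck.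
Qed.

Variables (a b : L).
Hypotheses (aK : a \in K3t) (bK : b \in K3t).
Local Notation f := (twoterm q t a b).

Lemma twoterm_in x : x \in K3t -> f x \in K3t.
Proof. by move=> xK; rewrite /twoterm rpredD // rpredM // rpredX. Qed.

Hypothesis no_eigen : forall x g, x \in K3t -> x != 0 -> g \in Kt -> f x <> g * x.

(* Otherwise [W = <y, f y>] is an invariant plane of [E]. Choose [v] outside [W], so that
   [f v = g v + w0] with [w0] in [W]. As [f - g] has no kernel it is onto [W], and it sends [v - w1]
   to [0] for some [w1] in [W]. *)
Lemma twoterm_no_invariant_plane y c d : y \in K3t -> y != 0 ->
  c \in Kt -> d \in Kt -> f (f y) <> c * f y + d * y.
Proof.
move=> yK y0 cK dK e.
have fy0 : f y != 0 by apply/eqP => fy0; apply: (no_eigen yK y0 (mem0v Kt)); rewrite mul0r.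
have fD x1 x2 : f (x1 + x2) = f x1 + f x2 by exact: linearD.
pose W := (Kt * <[y]> + Kt * <[f y]>)%VS.
have WP x : reflect (exists2 u, u \in Kt & exists2 v, v \in Kt & x = u * y + v * f y) (x \in W).
  apply: (iffP memv_addP) => [[_ /memv_cosetP[u uK ->] [_ /memv_cosetP[v vK ->] ->]]|].
    by exists u => //; exists v.
  move=> [u uK [v vK ->]]; exists (u * y); first by apply/memv_cosetP; exists u.
  by exists (v * f y) => //; apply/memv_cosetP; exists v.
have sc u v : v \in K3t -> u \in Kt -> u * v \in K3t.
  by move=> vK uK; rewrite rpredM // (subvP subfield_third).
have WK : (W <= K3t)%VS.
  by apply/subvP => x /WP[u uK [v vK ->]]; rewrite rpredD // sc // twoterm_in.
have WZ u x : u \in Kt -> x \in W -> u * x \in W.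
  move=> uK /WP[r rK [s sK ->]]; apply/WP; exists (u * r); first by rewrite rpredM.
  by exists (u * s); [rewrite rpredM | ring].
(* A nonzero vector common to both summands would make [f y] a [Kt]-multiple of [y]. *)
have dimW : \dim W = (2 * t)%N.
  rewrite dimv_disjoint_sum ?dim_cosetv ?hKt ?addnn ?mul2n //.
  apply/eqP; rewrite -subv0; apply/subvP => x /memv_capP[].
  case/memv_cosetP=> u uK -> /memv_cosetP[v vK uv]; rewrite memv0.
  have [v0|v0] := eqVneq v 0; first by rewrite uv v0 mul0r.
  case: (no_eigen yK y0 (rpredM (rpredVr vK) uK)).
  by rewrite -mulrA uv mulKf.
have /subvPn[v vK vW] : ~~ (K3t <= W)%VS.
  by apply/negP => /dimvS; rewrite dimW hK3t leq_pmul2r // (ltn_trans _ ht).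
have v0 : v != 0 by apply: contraNneq vW => ->; apply: mem0v.
have K3E : (W + Kt * <[v]> = K3t)%VS.
  apply/eqP; rewrite eqEdim; apply/andP; split.
    rewrite subv_add WK; apply/subvP => x /memv_cosetP[u uK ->]; exact: sc.
  rewrite dimv_disjoint_sum ?dim_cosetv ?hKt ?hK3t ?dimW -?mulSnr //.
  apply/eqP; rewrite -subv0; apply/subvP => x /memv_capP[xW].
  case/memv_cosetP=> u uK xE; rewrite memv0 xE; apply: contraR vW => uv0.
  have u0 : u != 0 by apply: contraNneq uv0 => ->; rewrite mul0r.
  by rewrite -(mulKf u0 v) WZ ?rpredVr // -xE.
have : f v \in (W + Kt * <[v]>)%VS by rewrite K3E twoterm_in.
case/memv_addP=> w0 w0W [_ /memv_cosetP[g gK ->] fv].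
pose h := (linfun f - amull g)%VF.
have hE x : h x = f x - g * x by rewrite add_lfunE opp_lfunE !lfunE.
have hW : (h @: W = W)%VS.
  apply/eqP; rewrite eqEdim; apply/andP; split.
    apply/subvP => _ /memv_imgP[x xW ->]; rewrite hE rpredB ?WZ //.
    case/WP: xW => r rK [s sK ->]; rewrite fD !twoterm_semilinear // e.
    apply/WP; exists (s ^+ q * d); first by rewrite rpredM ?rpredX.
    exists (r ^+ q + s ^+ q * c); first by rewrite rpredD ?rpredM ?rpredX.
    by ring.
  rewrite limg_dim_eq //; apply/eqP; rewrite -subv0; apply/subvP => x /memv_capP[xW].
  rewrite memv_ker hE subr_eq0 memv0 => /eqP fx; apply/eqP; apply/eqP; apply: contraPT fx => x0.
  exact: no_eigen (subvP WK _ xW) x0 gK.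
move: w0W; rewrite -hW => /memv_imgP[w1 w1W w0E].
have w1K := subvP WK _ w1W.
case: (no_eigen (x := v - w1) (g := g)) => //; first by rewrite rpredB.
  by rewrite subr_eq0; apply: contraNneq vW => ->.
have -> : f (v - w1) = f v - f w1 by exact: linearB.
by rewrite fv w0E hE; move: (f w1) => z; ring.
Qed.

End Twoterm.

(** * From the absence of eigenvectors to scatteredness *)

Section Scattered.

Variables (F : finFieldType) (L : fieldExtType F) (t : nat) (Kt K2t K3t : {subfield L}).
Variables (w a b : L).
Hypotheses (ht : (1 < t)%N).
Hypotheses (hKt : \dim Kt = t) (hK2t : \dim K2t = (2 * t)%N) (hK3t : \dim K3t = (3 * t)%N).
Hypotheses (wK2 : w \in K2t) (wKt : w \notin Kt) (aK : a \in K3t) (bK : b \in K3t).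
Local Notation q := #|F|.
Local Notation f := (twoterm q t a b).
Hypothesis no_eigen : forall x g, x \in K3t -> x != 0 -> g \in Kt -> f x <> g * x.

Let KtK2t : (Kt <= K2t)%VS.
Proof.
apply/subvP => x; rewrite !Fermat's_little_theorem hKt hK2t => /eqP xt.
by rewrite mul2n -addnn expnD exprM !xt.
Qed.

Let KtK3t : (Kt <= K3t)%VS. Proof. exact: subfield_third hKt hK3t. Qed.

(** If [w] is fixed by the powers [q^(2t)] and [q^(3t)], it is fixed by [q^t], so it lies in
    [Kt]. *)
Let wK3 : w \notin K3t.
Proof.
apply: contraNN wKt; move: wK2; rewrite !Fermat's_little_theorem hKt hK2t hK3t.
by rewrite (mulSnr 2) expnD exprM => /eqP ->.
Qed.

Let w_free x y x' y' : x \in K3t -> y \in K3t -> x' \in K3t -> y' \in K3t ->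
  x + w * y = x' + w * y' -> x = x' /\ y = y'.
Proof.
move=> xK yK x'K y'K e; suff yy' : y = y' by split=> //; rewrite yy' in e; apply: addIr e.
apply/eqP; apply: contraR wK3; rewrite -subr_eq0 => yy'.
have -> : w = (x' - x) / (y - y').
  apply: (mulIf yy'); rewrite divfK //; apply/eqP; rewrite -subr_eq0.
  rewrite [X in X == _](_ : _ = (x + w * y) - (x' + w * y')); last by ring.
  by rewrite e subrr.
by rewrite rpredM ?rpredVr ?rpredB.
Qed.

Let K2tP l : l \in K2t -> exists2 u, u \in Kt & exists2 v, v \in Kt & l = u + v * w.
Proof.
have w0 : w != 0 by apply: contraNneq wKt => ->; apply: mem0v.
have <- : (Kt + Kt * <[w]> = K2t)%VS.
  apply/eqP; rewrite eqEdim; apply/andP; split.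
    rewrite subv_add KtK2t; apply/subvP => x /memv_cosetP[u uK ->].
    by rewrite rpredM // (subvP KtK2t).
  rewrite dimv_disjoint_sum ?dim_cosetv ?hKt ?hK2t ?mul2n ?addnn //.
  apply/eqP; rewrite -subv0; apply/subvP => x /memv_capP[xK].
  case/memv_cosetP=> u uK xE; rewrite memv0 xE; apply: contraR wKt => uw0.
  have u0 : u != 0 by apply: contraNneq uw0 => ->; rewrite mul0r.
  by rewrite -(mulKf u0 w) rpredM ?rpredVr // -xE.
by case/memv_addP=> u uK [_ /memv_cosetP[v vK ->] ->]; exists u => //; exists v.
Qed.

Let g : 'End(L) := (linfun f + amull w)%VF.

Let gE x : g x = f x + w * x. Proof. by rewrite add_lfunE !lfunE. Qed.

Lemma dim_twoterm_space : \dim (g @: K3t) = (3 * t)%N.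
Proof.
rewrite limg_dim_eq ?hK3t //; apply/eqP; rewrite -subv0; apply/subvP => x.
case/memv_capP=> xK; rewrite memv_ker gE memv0 => /eqP e.
have e0 : f x + w * x = 0 + w * 0 by rewrite e mulr0 addr0.
by have [_ ->] := w_free (twoterm_in t aK bK xK) xK (mem0v _) (mem0v _) e0.
Qed.

(** Write [l = u + v w] and [w^2 = n + s w]. Comparing coordinates along [1] and [w] over [K3t]
    gives [x = (u + v s) y + v f y] and [f x = u f y + v n y]. Applying [f] to the first yields [v^q
    f (f y) + (u + v s)^q f y = u f y + v n y]. If [v != 0], the plane spanned by [y] and [f y] is
    invariant, which is excluded; if [v = 0], then [u^q = u] because [f y != 0]. *)
Lemma twoterm_space_dilation x y l : x \in K3t -> y \in K3t -> y != 0 -> l \in K2t ->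
  f x + w * x = l * (f y + w * y) -> l ^+ q = l.
Proof.
move=> xK yK y0 lK.
have [u uK [v vK ->]] := K2tP lK.
have [n nK [s sK w2]] := K2tP (rpredM wK2 wK2).
have fyK := twoterm_in t aK bK yK.
have K3 c : c \in Kt -> c \in K3t by apply: (subvP KtK3t).
have fD x1 x2 : f (x1 + x2) = f x1 + f x2 by exact: linearD.
have -> : (u + v * w) * (f y + w * y) =
    (u * f y + v * n * y) + w * ((u + v * s) * y + v * f y).
  transitivity (u * f y + w * (u * y + v * f y) + v * y * (w * w)).
    by move: (f y) => z; ring.
  by rewrite w2; move: (f y) => z; ring.
have [uK3 vK3 nK3 sK3] : [/\ u \in K3t, v \in K3t, n \in K3t & s \in K3t].
  by rewrite !K3.
have cK := rpredD (rpredM uK3 fyK) (rpredM (rpredM vK3 nK3) yK).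
have c'K := rpredD (rpredM (rpredD uK3 (rpredM vK3 sK3)) yK) (rpredM vK3 fyK).
case/(w_free (twoterm_in t aK bK xK) xK cK c'K) => fx xE.
move: fx; rewrite xE fD !(twoterm_semilinear hKt) ?rpredD ?rpredM // => e.
have [v0|v0] := eqVneq v 0.
  move: e; rewrite v0 !mul0r !addr0 expr0n /=.
  have -> : (q == 0)%N = false by apply/negbTE; rewrite -lt0n; apply/card_gt0P; exists 0.
  rewrite mul0r addr0 => /mulIf; apply.
  by apply/eqP => fy0; apply: (no_eigen yK y0 (mem0v Kt)); rewrite mul0r.
have vq : v ^+ q != 0 by rewrite expf_neq0.
case: (@twoterm_no_invariant_plane _ _ _ _ _ ht hKt hK3t _ _ aK bK no_eigen y
  (v ^- q * (u - (u + v * s) ^+ q)) (v ^- q * (v * n))) => //.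
- by rewrite rpredM ?rpredB ?rpredX ?rpredVr ?rpredD ?rpredM ?rpredX.
- by rewrite rpredM ?rpredX ?rpredVr ?rpredM ?rpredX.
move: e vq; move: (f (f y)) (f y) (v ^+ q) ((u + v * s) ^+ q) => z1 z2 r c e r0.
apply: (mulfI r0); transitivity (u * z2 + v * n * y - c * z2); last by field.
by rewrite -e; ring.
Qed.

Lemma scattered_twoterm : scattered (LinearSet K2t dim_twoterm_space).
Proof.
move=> v v0 /=; set I := (_ :&: _)%VS.
have [->|I0] := eqVneq I 0%VS; first by rewrite dimv0.
have uI := memv_pick I; set u := vpick I in uI.
have u0 : u != 0 by rewrite vpick0.
apply: (@leq_trans (\dim <[u]>)); last by rewrite dim_vline leq_b1.
apply/dimvS/subvP => z; move: uI; rewrite !memv_cap /span_over prodvC.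
case/andP=> /memv_imgP[y yK uE] /memv_cosetP[k kK uk].
case/andP=> /memv_imgP[x xK zE] /memv_cosetP[l lK zl].
have y0 : y != 0 by apply: contraNneq u0 => y0; rewrite uE y0 linear0.
have k0 : k != 0 by apply: contraNneq u0 => k0; rewrite uk k0 mul0r.
have zu : z = (l / k) * u by rewrite uk mulrA divfK.
have lkK : l / k \in K2t by rewrite rpredM ?rpredVr.
(* [1%AS] is the copy of [F] in [L], characterised by [x^q = x]; thus any [z] in the intersection is
   an [F]-multiple of the chosen [u]. *)
have : l / k \in (1%AS : {subfield L}).
  rewrite Fermat's_little_theorem dimv1 expn1; apply/eqP.
  apply: twoterm_space_dilation xK yK y0 lkK _.
  by rewrite -!gE -zE -uE.
by case/vlineP=> c lkE; rewrite zu lkE mulr_algl memvZ ?memv_line.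
Qed.

End Scattered.

Theorem theorem2p3 (q t : nat) (F : finFieldType) (L : fieldExtType F)
  (Kt K2t K3t : {subfield L}) (w : L)
  (hq : #|F| = q) (ht : (2 <= t)%N)
  (hL : \dim {:L} = (6 * t)%N)
  (hKt : \dim Kt = t) (hK2t : \dim K2t = (2 * t)%N)
  (hK3t : \dim K3t = (3 * t)%N)
  (hw : w \in K2t) (hw' : w \notin Kt) :
  exists (a b : L) (i : nat) (LU : linear_set K2t (3 * t)),
    [/\ (a \in K3t) && (a != 0),
        (b \in K3t) && (b != 0),
        (1 <= i <= 3 * t - 1)%N,
        (forall y : L, y \in ls_space LU <->
           exists2 x : L, x \in K3t
             & y = a * x ^+ (q ^ i) + b * x ^+ (q ^ (2 * t + i)) + w * x)
      & scattered LU].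
Proof.
have [a [b [aK bK no_eigen]]] := exists_twoterm_no_eigenvector ht hKt hK3t.
have [[aK3 _] [bK3 _]] := (andP aK, andP bK).
exists a, b, 1%N, (LinearSet K2t (dim_twoterm_space hKt hK2t hK3t hw hw' aK3 bK3)).
split=> //; first by lia.
  move=> y /=; rewrite expn1 -hq; split.
    by case/memv_imgP => x xK ->; exists x; rewrite // add_lfunE !lfunE.
  move=> [x xK ->]; apply/memv_imgP; exists x => //.
  by rewrite add_lfunE !lfunE.
exact: scattered_twoterm.
Qed.
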